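(* Let $\lambda,\mu,R,C>0$ and $\rho=\lambda/\mu$. For every entrance fee $p\in[0,R)$, the equilibrium joining fraction under independent customer behavior and the optimal joining fraction of the customers' leader under grouped behavior satisfy $$q_e^{(gr)}(p)\le q_e^{(ind)}(p).$$
   Context: Setting: unobservable M/M/1 queue with potential Poisson arrival rate $\lambda>0$, service rate $\mu>0$, service reward $R>0$, waiting cost rate $C>0$ per unit of time in system, and entrance fee $p\in[0,R)$. Put $\rho=\lambda/\mu$ (any positive value allowed) and $\nu(p)=(R-p)\mu/C$. If a fraction $q\in[0,1]$ of customers joins and $\rho q<1$, the mean sojourn time is $\frac{1}{\mu(1-\rho q)}$; if $\rho q\ge 1$ the expected waiting cost is infinite, so such $q$ are excluded. Independent behavior: $q_e^{(ind)}(p)$ is the unique symmetric equilibrium joining probability, i.e. the unique $q\in[0,1]$ with $\rho q<1$ such that $q$ maximizes $q'\mapsto q'\left(R-p-\frac{C}{\mu(1-\rho q)}\right)$ over $q'\in[0,1]$. It is known that $q_e^{(ind)}(p)=\min\left\{\frac1\rho\left(1-\frac{1}{\nu(p)}\right)^+,1\right\}$, where $x^+=\max(x,0)$. Grouped behavior: $q_e^{(gr)}(p)$ is the unique maximizer, over $q\in[0,1]$ with $\rho q<1$, of the aggregate customer surplus per unit time $\mathcal U^{(gr)}(q;p)=\lambda q\left(R-p-\frac{C}{\mu-\lambda q}\right)=C\rho q\left(\nu(p)-\frac{1}{1-\rho q}\right)$. *)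

(* Defs.v *)
From Stdlib Require Import Reals Lra Psatz ClassicalEpsilon.
Open Scope R_scope.

(* Notation: lam, mu = arrival and service rates, Rw = service reward (R is
   the type of reals), c = waiting cost rate, p = entrance fee, q = joining
   fraction. *)

Definition rho (lam mu : R) : R := lam / mu.

Definition feasible (lam mu q : R) : Prop :=
  0 <= q <= 1 /\ rho lam mu * q < 1.

(* Meaningful only when rho * q < 1. *)
Definition sojourn (lam mu q : R) : R := 1 / (mu * (1 - rho lam mu * q)).

(* Expected net benefit of a tagged customer who joins with probability q'
   while the others join with probability q. *)
Definition tagged_benefit (lam mu Rw c p q q' : R) : R :=
  q' * (Rw - p - c * sojourn lam mu q).

(* The deviation q' ranges over all of [0, 1]: a single customer does not
   affect the stability of the queue. *)
Definition is_ind_equilibrium (lam mu Rw c p q : R) : Prop :=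
  feasible lam mu q /\
  forall q', 0 <= q' <= 1 ->
    tagged_benefit lam mu Rw c p q q' <= tagged_benefit lam mu Rw c p q q.

Definition group_surplus (lam mu Rw c p q : R) : R :=
  lam * q * (Rw - p - c / (mu - lam * q)).

Definition is_gr_optimum (lam mu Rw c p q : R) : Prop :=
  feasible lam mu q /\
  forall q', feasible lam mu q' ->
    group_surplus lam mu Rw c p q' <= group_surplus lam mu Rw c p q.

(* Definite descriptions; see ind_equilibrium_unique_exists and
   gr_optimum_unique_exists below. *)
Definition q_ind (lam mu Rw c p : R) : R :=
  epsilon (inhabits 0) (is_ind_equilibrium lam mu Rw c p).

Definition q_gr (lam mu Rw c p : R) : R :=
  epsilon (inhabits 0) (is_gr_optimum lam mu Rw c p).

Lemma rho_lt_1 lam mu q : 0 < mu -> (rho lam mu * q < 1 <-> lam * q < mu).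
Proof.
intros hmu; unfold rho.
replace (lam / mu * q) with (lam * q / mu) by (field; lra).
split; intros h.
- apply (Rmult_lt_reg_r (/ mu)); [now apply Rinv_0_lt_compat|].
  rewrite Rinv_r by lra; exact h.
- apply (Rmult_lt_reg_r mu); [exact hmu|].
  unfold Rdiv; rewrite Rmult_assoc, Rinv_l by lra; lra.
Qed.

Lemma sojournE lam mu q : 0 < mu -> lam * q < mu ->
  sojourn lam mu q = / (mu - lam * q).
Proof.
intros hmu h; unfold sojourn, rho; field; repeat split; lra.
Qed.

Lemma ind_equilibrium_unique_exists (lam mu Rw c p : R) :
  0 < lam -> 0 < mu -> 0 < c -> p < Rw ->
  exists! q, is_ind_equilibrium lam mu Rw c p q.
Proof.
intros hl hm hc hp.
assert (hE : forall q, is_ind_equilibrium lam mu Rw c p q <->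
  (0 <= q <= 1 /\ lam * q < mu) /\ forall q', 0 <= q' <= 1 ->
  q' * (Rw - p - c * / (mu - lam * q)) <= q * (Rw - p - c * / (mu - lam * q))).
{ intros q; unfold is_ind_equilibrium, feasible, tagged_benefit.
  rewrite (rho_lt_1 lam mu q hm).
  split; intros [[h1 h2] h3]; split; try (split; assumption);
  intros q' hq'; specialize (h3 q' hq'); rewrite sojournE in *; assumption. }
set (d := Rw - p) in *; assert (hd : 0 < d) by (unfold d; lra).
assert (hs : forall y, 0 < y -> y * (c * / y) = c) by (intros; field; lra).
assert (hex : exists q, is_ind_equilibrium lam mu Rw c p q).
{ destruct (Rle_lt_dec (d * mu) c) as [h0|h0].
  { exists 0; apply hE; rewrite Rmult_0_r, Rminus_0_r.
    split; [lra|intros q' hq'].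
    assert (H := hs mu hm). assert (d <= c * / mu) by nra. nra. }
  destruct (Rle_lt_dec c (d * (mu - lam))) as [h1|h1].
  { exists 1; apply hE; rewrite Rmult_1_r.
    assert (hy : 0 < mu - lam) by nra.
    split; [lra|intros q' hq'].
    assert (H := hs _ hy). assert (c * / (mu - lam) <= d) by nra. nra. }
  exists ((mu - c / d) / lam); apply hE.
  assert (e : lam * ((mu - c / d) / lam) = mu - c / d) by (field; lra).
  assert (ecd : d * (c / d) = c) by (field; lra).
  set (z := c / d) in *.
  assert (hz : 0 < z) by nra.
  assert (0 < mu - z) by nra.
  set (q := (mu - z) / lam) in *.
  assert (0 <= q <= 1) by (split; nra).
  rewrite e; replace (mu - (mu - z)) with z by ring.
  split; [lra|intros q' hq'].
  assert (H2 := hs z hz). assert (c * / z = d) by nra. nra. }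
assert (hun : forall q1 q2, is_ind_equilibrium lam mu Rw c p q1 ->
  is_ind_equilibrium lam mu Rw c p q2 -> ~ q1 < q2).
{ intros q1 q2 H1 H2 hlt; apply hE in H1; apply hE in H2.
  destruct H1 as [[a1 b1] e1]; destruct H2 as [[a2 b2] e2].
  assert (k : / (mu - lam * q1) < / (mu - lam * q2))
    by (apply Rinv_lt_contravar; nra).
  specialize (e1 1 ltac:(lra)); specialize (e2 0 ltac:(lra)).
  assert (c * / (mu - lam * q1) < c * / (mu - lam * q2)) by nra.
  assert (0 <= d - c * / (mu - lam * q2)) by nra.
  nra. }
destruct hex as [q hq]; exists q; split; [exact hq|intros q' hq'].
assert (H1 := hun q q' hq hq'); assert (H2 := hun q' q hq' hq); lra.
Qed.

Lemma gr_optimum_unique_exists (lam mu Rw c p : R) :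
  0 < lam -> 0 < mu -> 0 < c -> p < Rw ->
  exists! q, is_gr_optimum lam mu Rw c p q.
Proof.
intros hl hm hc hp.
set (d := Rw - p); assert (hd : 0 < d) by (unfold d; lra).
assert (hf : forall q, feasible lam mu q <-> 0 <= q <= 1 /\ 0 < mu - lam * q).
{ intros q; unfold feasible; rewrite (rho_lt_1 lam mu q hm).
  split; intros [? ?]; split; lra. }
assert (hneg : forall x y, x <= 0 -> y <= 0 -> 0 <= x * y)
  by (intros; nra).
(* Comparison of two values in the variables y = mu - lam * q. *)
assert (hdiff : forall q q', 0 < mu - lam * q -> 0 < mu - lam * q' ->
  (group_surplus lam mu Rw c p q - group_surplus lam mu Rw c p q')
    * ((mu - lam * q) * (mu - lam * q'))
  = (lam * q - lam * q') * (d * ((mu - lam * q) * (mu - lam * q')) - c * mu)).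
{ intros q q' h h'; unfold group_surplus, d; field; lra. }
assert (hopt : forall q q', 0 < mu - lam * q -> 0 < mu - lam * q' ->
  0 <= (lam * q - lam * q') * (d * ((mu - lam * q) * (mu - lam * q')) - c * mu)
  <-> group_surplus lam mu Rw c p q' <= group_surplus lam mu Rw c p q).
{ intros q q' h h'; rewrite <- hdiff by assumption.
  assert (0 < (mu - lam * q) * (mu - lam * q')) by nra.
  split; intros k; nra. }
assert (hex : exists q, is_gr_optimum lam mu Rw c p q).
{ set (s := sqrt (c * mu / d)).
  assert (hcd : 0 < c * mu / d) by (apply Rdiv_lt_0_compat; nra).
  assert (hs0 : 0 < s) by (apply sqrt_lt_R0; exact hcd).
  assert (hss : d * (s * s) = c * mu).
  { unfold s; rewrite sqrt_sqrt by lra; field; lra. }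
  clearbody s.
  destruct (Rle_lt_dec mu s) as [h0|h0].
  { exists 0; split; [apply hf; lra|intros q' hq'; apply hf in hq'].
    destruct hq' as [hq' hy']; apply hopt; [lra|lra|].
    assert (0 <= lam * q') by nra.
    assert ((mu - lam * 0) * (mu - lam * q') <= s * s) by nra.
    rewrite <- hss, <- Rmult_minus_distr_l; apply hneg; nra. }
  destruct (Rle_lt_dec s (mu - lam)) as [h1|h1].
  { exists 1; split; [apply hf; lra|intros q' hq'; apply hf in hq'].
    destruct hq' as [hq' hy']; apply hopt; [lra|lra|].
    assert (lam * q' <= lam) by nra.
    assert (s * s <= (mu - lam * 1) * (mu - lam * q')) by nra.
    rewrite <- hss, <- Rmult_minus_distr_l; apply Rmult_le_pos; nra. }
  exists ((mu - s) / lam).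
  assert (e : lam * ((mu - s) / lam) = mu - s) by (field; lra).
  set (q := (mu - s) / lam) in *.
  split; [apply hf; repeat split; nra|intros q' hq'; apply hf in hq'].
  destruct hq' as [hq' hy']; apply hopt; [lra|lra|].
  rewrite e; replace (mu - (mu - s)) with s by ring.
  rewrite <- hss.
  set (y := mu - lam * q') in *.
  replace (mu - s - lam * q') with (y - s) by (unfold y; ring).
  replace ((y - s) * (d * (s * y) - d * (s * s)))
    with (d * s * ((y - s) * (y - s))) by ring.
  apply Rmult_le_pos; [nra|apply Rle_0_sqr]. }
assert (hun : forall q1 q2, is_gr_optimum lam mu Rw c p q1 ->
  is_gr_optimum lam mu Rw c p q2 -> ~ q1 < q2).
{ intros q1 q2 [f1 o1] [f2 o2] hlt.
  set (m := (q1 + q2) / 2).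
  assert (fm : feasible lam mu m).
  { apply hf in f1; apply hf in f2; apply hf; unfold m; split; [lra|nra]. }
  assert (m2 := o1 m fm); assert (m3 := o2 m fm).
  apply hf in f1; apply hf in f2; apply hf in fm.
  apply hopt in m2; [|tauto|tauto]; apply hopt in m3; [|tauto|tauto].
  assert (a1 : lam * q1 - lam * m < 0) by (unfold m; nra).
  assert (a2 : 0 < lam * q2 - lam * m) by (unfold m; nra).
  assert (b1 : d * ((mu - lam * q1) * (mu - lam * m)) <= c * mu) by nra.
  assert (b2 : c * mu <= d * ((mu - lam * q2) * (mu - lam * m))) by nra.
  assert (b3 : (mu - lam * q2) * (mu - lam * m)
    < (mu - lam * q1) * (mu - lam * m)) by nra.
  nra. }
destruct hex as [q hq]; exists q; split; [exact hq|intros q' hq'].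
assert (H1 := hun q q' hq hq'); assert (H2 := hun q' q hq' hq); lra.
Qed.

(* Main.v *)
Require Import Defs.
From Stdlib Require Import Reals Lra Psatz ClassicalEpsilon.
Open Scope R_scope.

(** If the leader's optimum exceeded the equilibrium [q], then [q < 1], so that
    joining for sure does not profit a tagged customer at [q], and is strictly
    unprofitable at the more congested leader's optimum.  The group surplus
    there would be negative, whereas nobody joining yields zero. *)

Lemma feasible_lt (lam mu q : R) :
  0 < mu -> feasible lam mu q -> lam * q < mu.
Proof. now intros hmu [_ h]; apply rho_lt_1. Qed.

Lemma feasible_0 (lam mu : R) : feasible lam mu 0.
Proof. unfold feasible; rewrite Rmult_0_r; lra. Qed.

(** Deviating from [q] to [1] changes the tagged customer's payoff by [1 - q > 0] times this net
    benefit. *)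
Lemma ind_equilibrium_benefit_le_0 (lam mu Rw c p q : R) :
  0 < mu -> is_ind_equilibrium lam mu Rw c p q -> q < 1 ->
  Rw - p - c / (mu - lam * q) <= 0.
Proof.
intros hmu [hq heq] hq1.
assert (h := heq 1 ltac:(lra)); unfold tagged_benefit in h.
rewrite (sojournE lam mu q hmu (feasible_lt lam mu q hmu hq)) in h.
unfold Rdiv; nra.
Qed.

(** The competitor [0] is feasible at every load and has zero surplus. *)
Lemma gr_optimum_surplus_ge_0 (lam mu Rw c p q : R) :
  is_gr_optimum lam mu Rw c p q -> 0 <= group_surplus lam mu Rw c p q.
Proof.
intros [_ hopt].
assert (h := hopt 0 (feasible_0 lam mu)).
unfold group_surplus at 1 in h; rewrite Rmult_0_r, Rmult_0_l in h; exact h.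
Qed.

Lemma gr_optimum_le_ind_equilibrium (lam mu Rw c p qg qi : R) :
  0 < lam -> 0 < mu -> 0 < c ->
  is_gr_optimum lam mu Rw c p qg -> is_ind_equilibrium lam mu Rw c p qi ->
  qg <= qi.
Proof.
intros hlam hmu hc hg hi.
destruct (Rle_lt_dec qg qi) as [|hlt]; [assumption|exfalso].
assert (hU := gr_optimum_surplus_ge_0 _ _ _ _ _ _ hg).
destruct hg as [fg _]; assert (lg := feasible_lt _ _ _ hmu fg).
assert (fi := proj1 hi).
destruct fg as [[g0 g1] _]; destruct fi as [[i0 _] _].
assert (hb := ind_equilibrium_benefit_le_0 _ _ _ _ _ _ hmu hi ltac:(lra)).
assert (hw : c / (mu - lam * qi) < c / (mu - lam * qg)).
{ apply Rmult_lt_compat_l; [assumption|].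
  assert (lam * qi < lam * qg) by nra.
  apply Rinv_lt_contravar; [apply Rmult_lt_0_compat|]; lra. }
unfold group_surplus in hU.
(* Since [0 <= qi < qg], the arrival rate is strictly positive, so a negative net benefit per
   customer contradicts [hU]. *)
assert (0 < lam * qg) by nra.
nra.
Qed.

Theorem mainTheorem1 (lam mu Rw c : R)
  (hlam : 0 < lam) (hmu : 0 < mu) (hRw : 0 < Rw) (hc : 0 < c)
  (p : R) (hp : 0 <= p < Rw) :
  q_gr lam mu Rw c p <= q_ind lam mu Rw c p.
Proof.
(* Existence of an optimum and of an equilibrium gives the [epsilon] choices their defining
   properties. *)
apply (gr_optimum_le_ind_equilibrium lam mu Rw c p); try assumption;
  [unfold q_gr | unfold q_ind]; apply epsilon_spec.
- destruct (gr_optimum_unique_exists lam mu Rw c p) as [q [hq _]];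
    [lra..|now exists q].
- destruct (ind_equilibrium_unique_exists lam mu Rw c p) as [q [hq _]];
    [lra..|now exists q].
Qed.
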